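(* There exist absolute constants $c,C>0$ such that the following holds. Let $p=p(n)$ satisfy $p\gg 1/n$ and $p=o(1)$, and let $G\sim G(n,p)$. Then, with high probability, both of the following statements hold. (i) Every $3$-edge-coloring of $G$ contains a monochromatic connected component of order at least $\frac{n}{2}-\frac{C}{p}$. (ii) There exists a $3$-edge-coloring of $G$ such that every monochromatic connected component has order at most $\frac{n}{2}-\frac{c}{p}$.
   Context: $G(n,p)$ is the binomial (Erdős–Rényi) random graph on $n$ labelled vertices, each pair being an edge independently with probability $p$. Asymptotics are as $n\to\infty$; $p\gg 1/n$ means $np\to\infty$, and ''with high probability'' means with probability tending to $1$. An $r$-edge-coloring assigns to each edge one of $r$ colors arbitrarily (not necessarily properly). A monochromatic connected component is a connected component of the spanning subgraph formed by all edges of one color; its order is its number of vertices. *)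

(* Defs.v *)
From HB Require Import structures.
From mathcomp Require Import all_boot all_order all_algebra.
From mathcomp Require Import all_classical all_reals all_analysis.

Set Implicit Arguments.
Unset Strict Implicit.
Unset Printing Implicit Defensive.

Import Order.TTheory GRing.Theory Num.Theory.
Import numFieldNormedType.Exports.

Local Open Scope classical_set_scope.
Local Open Scope ring_scope.

(* A simple graph on V is given by its edge set E : {set {set V}}, with
   E \subset vpairs V. *)
Definition vpairs (V : finType) : {set {set V}} :=
  [set e : {set V} | #|e| == 2%N].

Definition adj (V : finType) (E : {set {set V}}) : rel V :=
  fun x y => (x != y) && ([set x; y]%SET \in E).

Definition components (V : finType) (E : {set {set V}}) : {set {set V}} :=
  equivalence_partition (connect (adj E)) [set: V]%SET.

Definition edge_coloring (V : finType) (E : {set {set V}}) (r : nat) : Type :=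
  {ffun {e : {set V} | e \in E} -> 'I_r}.

Definition color_class (V : finType) (E : {set {set V}}) (r : nat)
    (f : edge_coloring E r) (i : 'I_r) : {set {set V}} :=
  [set val e | e : {e : {set V} | e \in E} & f e == i]%SET.

(* Components are taken in the spanning subgraph, so a vertex incident to no
   edge of color i forms a component of order 1. *)
Definition mono_component (V : finType) (E : {set {set V}}) (r : nat)
    (f : edge_coloring E r) (S : {set V}) : Prop :=
  exists i : 'I_r, S \in components (color_class f i).

Definition gnp_mass (R : realType) (n : nat) (p : R) (E : {set {set 'I_n}}) : R :=
  \prod_(e in vpairs 'I_n) (if e \in E then p else 1 - p).

Definition gnp_prob (R : realType) (n : nat) (p : R)
    (A : set {set {set 'I_n}}) : R :=
  \sum_(E in powerset (vpairs 'I_n) | `[< A E >]) gnp_mass p E.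

(* A n is a property of graphs on n labelled vertices. *)
Definition gnp_whp (R : realType) (p : nat -> R)
    (A : forall n : nat, set {set {set 'I_n}}) : Prop :=
  gnp_prob (p n) (A n) @[n --> \oo] --> (1 : R).

(* Main.v *)
Require Import Defs.
From HB Require Import structures.
From mathcomp Require Import all_boot all_order all_algebra.
From mathcomp Require Import all_classical all_reals all_analysis.
From mathcomp Require Import zify lra.
(* The last import makes names such as setIC and closed refer to finite sets
   and relations again, rather than to classical sets and topologies. *)
From mathcomp Require Import fintype finset fingraph.

Set Implicit Arguments.
Unset Strict Implicit.
Unset Printing Implicit Defensive.

Import Order.TTheory GRing.Theory Num.Theory.
Import numFieldNormedType.Exports.

(** With high probability G(n,p) has two properties, both obtained by a union
    bound, and both parts of the theorem follow from them deterministically.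

    The first property is that disjoint vertex sets [A], [B] without an edge
    between them satisfy [p * #|A| * #|B| < 3 * n] ([gnp_prob_large_gap]). In
    particular a set of linear size misses only O(1/p) vertices from its
    neighborhood, so the argument for complete graphs works up to O(1/p)
    ([large_monochromatic_component]). Group the components of the first color
    into two balanced sides, and do the same for the second color; a component
    too large for this is already large enough. The two bipartitions cut the
    vertices into four cells, and diagonally opposite cells are joined by the
    third color only. If all cells have linear size, then two components of the
    third color, one per diagonal, cover all but O(1/p) vertices
    ([large_component_of_large_cells]). If some cell is small, there is room to
    spare ([large_component_of_small_cell]).

    The second property is that a given set of 3a vertices, where a is a small
    constant over p, has at most n/6 outer neighbors
    ([gnp_prob_many_neighbors]). In the coloring of the complete graph whose
    components have order n/2, the vertex set is cut into four quarters, and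
    each color joins them along one perfect matching of K4. Here the 3a special
    vertices are taken out and cut into three extra parts of size a, one per
    color, and the first quarter is chosen to contain all their outer
    neighbors. An extra part sends only its own color to that quarter, and two
    different extra parts are joined by the third color. Then in each color two
    of the extra parts lie in neither of the two large components, which have
    therefore n - 2a vertices in total; making the first quarter smaller by a
    balances them in all three colors at once, at order n/2 - a up to rounding
    ([small_components_coloring]). As p tends to 0, a tends to infinity and
    absorbs the rounding. *)

(** * Components and closed sets of a symmetric relation *)

Definition component (V : finType) (e : rel V) (x : V) : {set V} :=
  [set y | connect e x y].

Section ClosedSets.
Variables (V : finType) (e : rel V).
Hypothesis e_sym : symmetric e.

Lemma closed_component x : closed e (mem (component e x)).
Proof.
move=> y z eyz; rewrite !inE.
by rewrite (same_connect_r (sym_connect_sym e_sym) (connect1 eyz)).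
Qed.

Lemma closedC (X : {set V}) :
  closed e (mem X) -> closed e (mem (~: X)).
Proof.
by move=> clX x y exy; rewrite !inE; congr (~~ _); apply: (clX x y exy).
Qed.

Lemma closedD (X Y : {set V}) :
    closed e (mem X) -> closed e (mem Y) ->
  closed e (mem (X :\: Y)).
Proof.
move=> clX clY x y exy; rewrite !inE.
by congr (~~ _ && _); [apply: (clY x y exy) | apply: (clX x y exy)].
Qed.

(** Peeling components off [V] one at a time, the share of [U] cannot jump
    from above 2/3 to below 1/3 unless the peeled component holds a third of
    [U] by itself. *)
Lemma balanced_closed_set (U : {set V}) : 0 < #|U| ->
  exists X : {set V}, [/\ closed e (mem X), #|U| <= 3 * #|U :&: X| &
    (exists x, X = component e x) \/ 3 * #|U :&: X| <= 2 * #|U|].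
Proof.
move=> U_gt0.
suff peel m (X : {set V}) : #|X| <= m -> closed e (mem X) ->
    #|U| <= 3 * #|U :&: X| ->
  exists X : {set V}, [/\ closed e (mem X), #|U| <= 3 * #|U :&: X| &
    (exists x, X = component e x) \/ 3 * #|U :&: X| <= 2 * #|U|].
  apply: (peel _ [set: V]) => //; first by move=> x y _; rewrite !inE.
  by rewrite setIT leq_pmull.
elim: m X => [|m IHm] X leXm clX UX.
  move: leXm UX; rewrite leqn0 cards_eq0 => /eqP ->.
  by rewrite setI0 cards0; lia.
have [|UX23] := leqP (3 * #|U :&: X|) (2 * #|U|).
  by move=> UX23; exists X; split=> //; right.
have [x] : exists x, x \in X.
  have /card_gt0P[x] : 0 < #|U :&: X| by lia.
  by rewrite inE => /andP[_ Xx]; exists x.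
move=> Xx; set K := component e x.
have subKX : K \subset X.
  by apply/subsetP => y; rewrite inE => /(closed_connect clX) <-.
have xK : x \in K by rewrite inE connect0.
have [UK|UK] := leqP #|U| (3 * #|U :&: K|).
  by exists K; split=> //; [exact: closed_component | left; exists x].
have cardUX : #|U :&: K| + #|U :&: (X :\: K)| = #|U :&: X|.
  rewrite -(cardsID K (U :&: X)) -setIA (setIidPr subKX).
  by rewrite -setIDA.
apply: (IHm (X :\: K)); last by lia.
- have := cardsID K X; rewrite (setIidPr subKX).
  by have : 0 < #|K| by [apply/card_gt0P; exists x]; lia.
- exact: closedD clX (@closed_component x).
Qed.

End ClosedSets.

(** * Monochromatic components in relations without large gaps *)

Definition disconnects (V : finType) (g : rel V) (A B : {set V}) : bool :=
  [disjoint A & B] && [forall x in A, forall y in B, ~~ g x y].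

Lemma disconnectsP (V : finType) (g : rel V) (A B : {set V}) :
  reflect ([disjoint A & B] /\ {in A & B, forall x y, ~~ g x y})
          (disconnects g A B).
Proof.
apply: (iffP andP) => -[dAB noE]; split=> //.
  by move=> x y Ax By; have /forall_inP/(_ x Ax)/forall_inP/(_ y By) := noE.
by apply/forall_inP => x Ax; apply/forall_inP => y By; apply: noE.
Qed.

(** In G(n,p) this holds with high probability for some [N] of order n/p. *)
Definition small_gaps (V : finType) (g : rel V) (N : nat) : Prop :=
  forall A B : {set V}, disconnects g A B -> #|A| * #|B| < N.

Lemma gap_side_bound k n a b D : n <= k * a -> a * b < n * D -> b < k * D.
Proof.
move=> nka abnD; have n_gt0 : 0 < n by case: n abnD {nka}.
rewrite -(ltn_pmul2l n_gt0); apply: leq_ltn_trans (_ : k * (a * b) < _).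
  by rewrite mulnA leq_mul2r nka orbT.
have k_gt0 : 0 < k by case: k nka => //; lia.
by rewrite [n * _]mulnCA ltn_pmul2l.
Qed.

Lemma leq_card_disjointD (V : finType) (U W K : {set V}) :
  [disjoint U & W] -> #|U| + #|W| <= #|K| + #|U :\: K| + #|W :\: K|.
Proof.
move=> dUW; rewrite -(cardsID K U) -(cardsID K W).
suff: #|U :&: K| + #|W :&: K| <= #|K| by lia.
have /eqP <- : #|(U :&: K) :|: (W :&: K)| == #|U :&: K| + #|W :&: K|.
  rewrite (leq_card_setU (U :&: K) (W :&: K)).
  by apply: disjointWl (subsetIl _ _) _; apply: disjointWr (subsetIl _ _) _.
by apply: subset_leq_card; rewrite -setIUl subsetIr.
Qed.

(** A closed set [X] with a third of [U] has almost all of [W], since few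
    vertices of [W] can be without a neighbor in [U :&: X]. If it left out a
    third of [U], it would also miss almost all of [W]. So the balanced closed
    set of the previous section is a component, and having almost all of [W] it
    misses few vertices of [U]. *)
Lemma almost_spanning_component (V : finType) (g e : rel V) (D : nat)
    (U W : {set V}) :
    symmetric e -> small_gaps g (#|V| * D) -> 1600 * D <= #|V| ->
    [disjoint U & W] -> #|V| <= 16 * #|U| -> #|V| <= 16 * #|W| ->
    {in U & W, forall x y, g x y -> e x y} ->
  exists x, #|U :\: component e x| <= 48 * D /\
            #|W :\: component e x| <= 48 * D.
Proof.
move=> e_sym gapg leDV dUW UV WV ge.
have gap (X Y : {set V}) : X \subset U -> Y \subset W ->
    {in X & Y, forall x y, ~~ e x y} -> #|X| * #|Y| < #|V| * D.
  move=> /subsetP XU /subsetP YW noe; apply: gapg; apply/disconnectsP; split.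
    apply: disjointWl (introT subsetP XU) _.
    exact: disjointWr (introT subsetP YW) dUW.
  move=> x y Xx Yy; apply: contra (noe x y Xx Yy) => gxy.
  by apply: ge; rewrite ?XU ?YW.
have V_gt0 : 0 < #|V|.
  suff : 0 < #|V| * D by rewrite muln_gt0 => /andP[].
  apply: leq_ltn_trans (gap set0 set0 (sub0set _) (sub0set _) _) => //.
  by move=> x y; rewrite inE.
have [|X [clX UX XKor]] := @balanced_closed_set V e e_sym U; first by lia.
have gap1 : #|U :&: X| * #|W :\: X| < #|V| * D.
  apply: gap; rewrite ?subsetIl ?subsetDl // => x y; rewrite !inE.
  move=> /andP[_ Xx] /andP[NXy _]; apply: contra NXy => exy.
  by rewrite -[y \in X](clX x y exy).
have gap2 : #|U :\: X| * #|W :&: X| < #|V| * D.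
  apply: gap; rewrite ?subsetIl ?subsetDl // => x y; rewrite !inE.
  move=> /andP[NXx _] /andP[_ Xy]; apply: contra NXx => exy.
  by rewrite [x \in X](clX x y exy).
have cU := cardsID X U; have cW := cardsID X W.
have WX : #|W :\: X| < 48 * D.
  by apply: gap_side_bound gap1; lia.
case: XKor => [[x defX]|UX23]; last first.
  have : #|W :&: X| < 48 * D by apply: gap_side_bound gap2; lia.
  (* Now #|W| < 96 * D, while 16 * #|W| is at least 1600 * D. *)
  by lia.
have UX' : #|U :\: X| < 48 * D.
  by rewrite mulnC in gap2; apply: gap_side_bound gap2; lia.
by exists x; rewrite -defX; split; exact: ltnW.
Qed.

Section ThreeColors.
Variables (V : finType) (g e0 e1 e2 : rel V) (D : nat).
Hypotheses (e1_sym : symmetric e1) (e2_sym : symmetric e2).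
Hypothesis g_colored : forall x y, g x y -> [|| e0 x y, e1 x y | e2 x y].
Hypotheses (gapg : small_gaps g (#|V| * D)) (D_small : 1600 * D <= #|V|).

(** The vertices split by [A] (no [e0]-edge across) and by [X] (no [e1]-edge
    across) into four cells, and diagonally opposite cells see each other only
    through [e2]. If the cell [A :&: X] is negligible, some [e2]-component [K]
    takes almost all of [A :\: X] and [X :\: A]. If moreover [K] takes most of
    the last cell, it is huge. Otherwise the part of the last cell outside [K]
    sees the part of [A :\: X] inside [K] only through [e1], and the
    [e1]-component so obtained has together with [K] about [#|V| + #|A|]
    vertices. *)
Lemma large_component_of_small_cell (A X : {set V}) :
    closed e0 (mem A) -> closed e1 (mem X) ->
    #|V| <= 3 * #|A| -> #|V| <= 3 * #|~: A| ->
    #|V| <= 3 * #|X| -> #|V| <= 3 * #|~: X| ->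
    16 * #|A :&: X| < #|V| ->
  exists x, #|V| <= 2 * #|component e1 x| \/ #|V| <= 2 * #|component e2 x|.
Proof.
move=> clA clX A3 NA3 X3 NX3 smallAX.
have cA := cardsID X A; have cNA := cardsID X (~: A).
have cX := cardsID A X; have cNX := cardsID A (~: X).
rewrite [X :&: A]setIC in cX; rewrite [~: X :&: A]setIC -setDE in cNX.
have eqBX : ~: A :&: X = X :\: A by rewrite setIC -setDE.
have eqBNX : ~: X :\: A = ~: A :\: X by rewrite !setDE setIC.
rewrite eqBX in cNA; rewrite eqBNX in cNX.
have cV := cardsC A.
have [||||x [KA KB]] :=
  @almost_spanning_component V g e2 D (A :\: X) (X :\: A) e2_sym gapg D_small.
- rewrite disjoints_subset; apply/subsetP => y; rewrite !inE.
  by move=> /andP[/negPf ->]; rewrite andbF.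
- by lia.
- by lia.
- move=> y z; rewrite !inE => /andP[NXy Ay] /andP[NAz Xz] /g_colored.
  case/or3P => // [/clA|/clX] eqyz.
    by rewrite [y \in A]eqyz (negPf NAz) in Ay.
  by rewrite [z \in X](esym eqyz) (negPf NXy) in Xz.
move defK: (component e2 x) KA KB => K KA KB.
have clK : closed e2 (mem K) by rewrite -defK; apply: closed_component.
set C := ~: A :\: X.
have cAK := cardsID K (A :\: X).
have cNAK := cardsID X (~: A :\: K).
have eq1 : (~: A :\: K) :&: X = (X :\: A) :\: K.
  by rewrite !setDE setIAC [~: A :&: X]setIC.
have eq2 : (~: A :\: K) :\: X = C :\: K by rewrite /C !setDE setIAC.
rewrite eq1 eq2 in cNAK.
have sizeK : #|A :\: X| + #|~: A| <= #|K| + #|(A :\: X) :\: K| + #|~: A :\: K|.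
  apply: leq_card_disjointD; rewrite disjoints_subset setCK.
  exact: subsetDl.
have [smallC|largeC] := leqP (16 * #|C :\: K|) #|V|.
  by exists x; right; rewrite defK; lia.
have dis : [disjoint (A :\: X) :&: K & C :\: K].
  rewrite disjoints_subset; apply/subsetP => z; rewrite !inE.
  by move=> /andP[_ ->].
have [||||y [LA LC]] :=
  @almost_spanning_component V g e1 D ((A :\: X) :&: K) (C :\: K) e1_sym gapg D_small.
- exact: dis.
- by lia.
- by lia.
- move=> y z; rewrite !inE => /andP[/andP[NXy Ay] Ky] /and3P[NKz NXz NAz] /g_colored.
  case/or3P => // [/clA|/clK] eqyz.
    by rewrite [y \in A]eqyz (negPf NAz) in Ay.
  by rewrite [y \in K]eqyz (negPf NKz) in Ky.
have sizeL := @leq_card_disjointD V _ _ (component e1 y) dis.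
have [Lbig|Lsmall] := leqP #|V| (2 * #|component e1 y|).
  by exists y; left.
(* Up to O(D), the two components have at least [2 * #|A :\: X| + #|~: A|]
   vertices together, and [A :\: X] is almost all of [A]. *)
by exists x; right; rewrite defK; lia.
Qed.

(** Each of the two diagonal pairs of cells is almost covered by one component
    of [e2], and the larger of these two components has half of the total. *)
Lemma large_component_of_large_cells (A X : {set V}) :
    closed e0 (mem A) -> closed e1 (mem X) ->
    #|V| <= 16 * #|A :&: X| -> #|V| <= 16 * #|A :\: X| ->
    #|V| <= 16 * #|X :\: A| -> #|V| <= 16 * #|~: A :\: X| ->
  exists x, #|V| <= 2 * #|component e2 x| + 192 * D.
Proof.
move=> clA clX AX ANX NAX NANX.
have spans (A' : {set V}) : closed e0 (mem A') ->
    #|V| <= 16 * #|A' :&: X| -> #|V| <= 16 * #|~: A' :\: X| ->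
  exists x, #|A' :&: X| + #|~: A' :\: X| <= #|component e2 x| + 96 * D.
  move=> clA' AX' NANX'.
  have dis : [disjoint A' :&: X & ~: A' :\: X].
    rewrite disjoints_subset; apply/subsetP => y; rewrite !inE.
    by move=> /andP[-> ->].
  have [//|//||x [K1 K2]] :=
    @almost_spanning_component V g e2 D (A' :&: X) (~: A' :\: X) e2_sym gapg D_small dis.
    move=> y z; rewrite !inE => /andP[Ay Xy] /andP[NXz NAz] /g_colored.
    case/or3P => // [/clA'|/clX] eqyz.
      by rewrite [y \in A']eqyz (negPf NAz) in Ay.
    by rewrite [y \in X]eqyz (negPf NXz) in Xy.
  by exists x; have := @leq_card_disjointD _ _ _ (component e2 x) dis; lia.
have [//|//|x Kx] := spans A clA.
have [||y Ky] := spans (~: A) (closedC clA); rewrite ?setCK //.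
  by rewrite setIC -setDE.
have cA := cardsID X A; have cNA := cardsID X (~: A).
have cV := cardsC A.
rewrite setCK in Ky.
have [Kbig|Ksmall] := leqP #|V| (2 * #|component e2 x| + 192 * D).
  by exists x.
by exists y; lia.
Qed.

End ThreeColors.

(** This is the argument for complete graphs with an error term. Unless a
    component of [e0] or [e1] is already large enough, both relations have a
    balanced closed set, and these two sets define the four cells. *)
Lemma large_monochromatic_component (V : finType) (g e0 e1 e2 : rel V) (D : nat) :
    symmetric e0 -> symmetric e1 -> symmetric e2 ->
    (forall x y, g x y -> [|| e0 x y, e1 x y | e2 x y]) ->
    small_gaps g (#|V| * D) -> 1600 * D <= #|V| ->
  exists x, [\/ #|V| <= 2 * #|component e0 x| + 192 * D,
                #|V| <= 2 * #|component e1 x| + 192 * D |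
                #|V| <= 2 * #|component e2 x| + 192 * D].
Proof.
move=> e0_sym e1_sym e2_sym g_colored gapg D_small.
have V_gt0 : 0 < #|[set: V]|.
  suff : 0 < #|V| * D by rewrite cardsT muln_gt0 => /andP[].
  apply: leq_ltn_trans (gapg set0 set0 _) => //; apply/disconnectsP.
  by split=> [|x y]; rewrite ?inE // disjoints_subset sub0set.
have split_balanced (e : rel V) : symmetric e ->
    (exists x, #|V| <= 2 * #|component e x|) \/
    exists X : {set V},
      [/\ closed e (mem X), #|V| <= 3 * #|X| & #|V| <= 3 * #|~: X|].
  move=> e_sym; have [X [clX X3 Xor]] := balanced_closed_set e_sym V_gt0.
  rewrite setTI cardsT in X3 Xor.
  have cX := cardsC X.
  have [Xbig|Xsmall] := leqP (3 * #|X|) (2 * #|V|).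
    by right; exists X; split=> //; lia.
  case: Xor => [[x defX]|]; last by lia.
  by left; exists x; rewrite -defX; lia.
have [[x Kx]|[A [clA A3 NA3]]] := split_balanced e0 e0_sym.
  by exists x; apply: Or31; lia.
have [[x Kx]|[X [clX X3 NX3]]] := split_balanced e1 e1_sym.
  by exists x; apply: Or32; lia.
have small (A' X' : {set V}) : closed e0 (mem A') -> closed e1 (mem X') ->
    #|V| <= 3 * #|A'| -> #|V| <= 3 * #|~: A'| ->
    #|V| <= 3 * #|X'| -> #|V| <= 3 * #|~: X'| ->
    16 * #|A' :&: X'| < #|V| ->
  exists x, [\/ #|V| <= 2 * #|component e0 x| + 192 * D,
                #|V| <= 2 * #|component e1 x| + 192 * D |
                #|V| <= 2 * #|component e2 x| + 192 * D].
  move=> clA' clX' hA hNA hX hNX hAX.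
  have [x [K1|K2]] := large_component_of_small_cell e1_sym e2_sym g_colored
    gapg D_small clA' clX' hA hNA hX hNX hAX.
    by exists x; apply: Or32; lia.
  by exists x; apply: Or33; lia.
have clNA := closedC clA; have clNX := closedC clX.
have [AX|] := leqP #|V| (16 * #|A :&: X|); last by apply: small.
have [ANX|] := leqP #|V| (16 * #|A :&: ~: X|); last first.
  by apply: small; rewrite ?setCK.
have [NAX|] := leqP #|V| (16 * #|~: A :&: X|); last first.
  by apply: small; rewrite ?setCK.
have [NANX|] := leqP #|V| (16 * #|~: A :&: ~: X|); last first.
  by apply: small; rewrite ?setCK.
rewrite -!setDE [~: A :&: X]setIC -setDE in ANX NAX NANX.
have [x Kx] := large_component_of_large_cells e2_sym g_colored gapg D_small
  clA clX AX ANX NAX NANX.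
by exists x; apply: Or33.
Qed.

(** * Colorings whose components stay inside the blocks of given partitions *)

Lemma adj_sym (V : finType) (E : {set {set V}}) : symmetric (adj E).
Proof. by move=> x y; rewrite /adj eq_sym setUC. Qed.

Lemma componentsP (V : finType) (E : {set {set V}}) (S : {set V}) :
  reflect (exists x, S = component (adj E) x) (S \in components E).
Proof.
apply: (iffP imsetP) => [[x _ ->]|[x ->]]; exists x; rewrite ?inE //;
  by apply/setP => y; rewrite !inE.
Qed.

Lemma mem_color_class (V : finType) (E : {set {set V}}) (r : nat)
    (f : edge_coloring E r) (i : 'I_r) (e : {set V}) :
  reflect (exists Ee : e \in E, f (exist _ e Ee) = i) (e \in color_class f i).
Proof.
apply: (iffP imsetP) => [[[e' Ee'] /= + ->]|[Ee fe]].
  by rewrite inE => /eqP fe; exists Ee'.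
by exists (exist _ e Ee); rewrite ?inE ?fe /=.
Qed.

(** Giving each edge a color whose partition does not separate its ends keeps
    every component of that color inside one block. *)
Lemma coloring_of_partitions (V : finType) (E : {set {set V}}) (r : nat)
    (blk : 'I_r.+1 -> V -> nat) :
    (forall x y, adj E x y -> exists i, blk i x = blk i y) ->
  exists f : edge_coloring E r.+1, forall i S,
    S \in components (color_class f i) ->
    exists b, S \subset [set x | blk i x == b].
Proof.
move=> blkE.
pose inside i (e : {set V}) := [forall x in e, forall y in e, blk i x == blk i y].
pose f : edge_coloring E r.+1 :=
  [ffun e => odflt ord0 [pick i | inside i (val e)]].
exists f => i S /componentsP[x ->]; exists (blk i x).
apply/subsetP => y; rewrite !inE.
have clx : closed (adj (color_class f i)) [pred z | blk i z == blk i x].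
  move=> u w /andP[uw /mem_color_class[Euw]]; rewrite !inE ffunE /=.
  case: pickP => [j /forall_inP ins /= ji|none].
    rewrite ji in ins.
    by have /forall_inP/(_ w (set22 _ _))/eqP -> := ins u (set21 _ _).
  have [|k eqk] := blkE u w; first by rewrite /adj uw.
  have /negP[] := negbT (none k).
  apply/forall_inP => s /set2P[]->; apply/forall_inP => t /set2P[]->;
  by rewrite ?eqk.
by move=> /(closed_connect clx); rewrite !inE eqxx.
Qed.

(** Labels [0] to [3] are the quarters of the vertex set; label [4 + i] is an
    extra part meant for color [i]. On the quarters, color [i] pairs them up
    along the [i]-th perfect matching of K4. The extra part of color [i] joins
    the block of the quarter [0], and the two other extra parts form a small
    third block. *)
Definition block (i l : nat) : nat :=
  nth 0 (nth [::] [:: [:: 0; 0; 1; 1; 0; 2; 2];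
                      [:: 0; 1; 0; 1; 2; 0; 2];
                      [:: 0; 1; 1; 0; 2; 2; 0]] i) l.

(** The rounding error in cutting the vertices into quarters goes to the label
    [3]. *)
Definition part_size (a v l : nat) : nat :=
  nth 0 [:: v - a; v; v; v + 3; a; a; a] l.

(** Two labels share a block in some color, except for an extra part and one of
    the quarters [1], [2], [3]. In each color the quarter [0] and the extra part
    of that color together count as one full quarter of size [v], so that both
    large blocks consist of two full quarters, up to rounding. *)
Lemma small_components_of_labels (V : finType) (E : {set {set V}})
    (lab : V -> 'I_7) (a v : nat) :
    (forall x y, adj E x y -> lab x < 4 -> 4 <= lab y -> lab x = 0 :> nat) ->
    a <= v -> (forall l, #|[set x | lab x == l]| <= part_size a v l) ->
  exists f : edge_coloring E 3, forall S,
    mono_component f S -> #|S| <= 2 * v + 3.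
Proof.
move=> extra_nbr av sizes.
have [x y xy|f fP] := @coloring_of_partitions V E 2 (fun i x => block i (lab x)).
  have share l m : l < 7 -> m < 7 -> (l < 4 -> 4 <= m -> l = 0) ->
      (m < 4 -> 4 <= l -> m = 0) ->
      [|| block 0 l == block 0 m, block 1 l == block 1 m | block 2 l == block 2 m].
    case: l => [|[|[|[|[|[|[|l]]]]]]]; case: m => [|[|[|[|[|[|[|m]]]]]]] //=;
    by lia.
  have yx : adj E y x by rewrite adj_sym.
  have := share _ _ (ltn_ord (lab x)) (ltn_ord (lab y))
    (extra_nbr x y xy) (extra_nbr y x yx).
  case/or3P => /eqP eqb; [exists (@Ordinal 3 0 isT) | exists (@Ordinal 3 1 isT)
                         | exists (@Ordinal 3 2 isT)]; exact: eqb.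
exists f => S [i /fP[b /subset_leq_card leS]]; apply: leq_trans leS _.
rewrite -sum1dep_card (partition_big lab (fun l : 'I_7 => block i l == b)) //=.
apply: leq_trans (_ : \sum_(l : 'I_7 | block i l == b)
    part_size a v l <= _).
  apply: leq_sum => l _; rewrite sum1dep_card.
  apply: leq_trans (sizes l); apply/subset_leq_card/subsetP => x.
  by rewrite !inE => /andP[].
rewrite big_mkcond !big_ord_recl big_ord0 /part_size /block /=.
case: i => [[|[|[|i]]] lti]; case: b => [|[|[|b]]] //=; lia.
Qed.

Lemma card_index_interval (T : finType) (s : seq T) (lo hi : nat) :
  #|[set x in s | lo <= index x s < hi]| <= hi - lo.
Proof.
apply: leq_trans (_ : #|take (hi - lo) (drop lo s)| <= _); last first.
  by apply: leq_trans (card_size _) _; rewrite size_take; case: ifP => //; lia.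
apply/subset_leq_card/subsetP => x; rewrite inE => /and3P[sx lox xhi].
have ltxs : index x s < size s by rewrite index_mem.
have := @mem_nth _ x (take (hi - lo) (drop lo s)) (index x s - lo).
rewrite nth_take ?nth_drop ?subnKC ?nth_index //; last by lia.
apply; rewrite size_take size_drop; case: ifP => _.
  exact: ltn_sub2r (leq_ltn_trans lox xhi) xhi.
exact: ltn_sub2r (leq_ltn_trans lox ltxs) ltxs.
Qed.

(** Listing [N], then the other vertices outside [A], then [A], the labels can
    be given to consecutive intervals of this list: [N] is covered by the label
    [0], and [A] by the last three. *)
Lemma labels_around (V : finType) (A N : {set V}) (n a v : nat) :
    #|V| = n -> #|A| = 3 * a -> N \subset ~: A -> #|N| + a <= v ->
    4 * v + 2 * a <= n <= 4 * v + 2 * a + 3 ->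
  exists lab : V -> 'I_7, [/\
    forall x, (4 <= lab x) = (x \in A),
    {in N, forall x, lab x = 0 :> nat} &
    forall l : 'I_7, #|[set x | lab x == l]| <=part_size a v l].
Proof.
move=> cV cA NA cN /andP[cV1 cV2]; have av : a <= v by lia.
pose s := enum N ++ enum (~: A :\: N) ++ enum A.
have s_all x : x \in s.
  by rewrite !mem_cat !mem_enum !inE; case: (x \in A); case: (x \in N).
pose bounds := [:: v - a; 2 * v - a; 3 * v - a; n - 3 * a; n - 2 * a; n - a].
pose lab x : 'I_7 := inord (count (fun t => t <= index x s) bounds).
have labE x : lab x = count (fun t => t <= index x s) bounds :> nat.
  by rewrite inordK // ltnS; exact: count_size.
have cNA : #|N| + #|~: A :\: N| = n - 3 * a.
  rewrite -cV -cA -(cardsC A) addKn -(cardsID N (~: A)); congr (_ + _).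
  by rewrite (setIidPr NA).
exists lab; split=> [x|x Nx|l].
- have memNA : (x \in enum N ++ enum (~: A :\: N)) = (x \notin A).
    rewrite mem_cat !mem_enum !inE; have := subsetP NA x; rewrite inE.
    by case: (x \in N) => //= ->.
  have [ltx gex] : (x \notin A -> index x s < n - 3 * a) /\
                   (x \in A -> n - 3 * a <= index x s).
    rewrite -cNA !cardE -size_cat /s catA index_cat memNA.
    by split=> [NAx|Ax]; rewrite ?NAx ?Ax ?leq_addr // index_mem memNA.
  rewrite labE; apply/idP/idP => [|/gex geNA]; last first.
    rewrite /=; have [-> -> ->] : [/\ v - a <= index x s, 2 * v - a <= index x s
                        & 3 * v - a <= index x s] by split; lia.
    by rewrite geNA.
  by apply: contraTT => /ltx; rewrite /=; lia.
- rewrite labE; have : index x s < #|N|.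
    by rewrite /s index_cat mem_enum Nx cardE index_mem mem_enum.
  move=> ltxN; apply/eqP; rewrite -leqn0 leqNgt -has_count; apply/hasPn => t.
  by rewrite !inE => tb; lia.
pose lo := nth 0 (0 :: bounds) l; pose hi := nth n bounds l.
apply: (@leq_trans (hi - lo)); last first.
  rewrite /hi /lo /bounds /part_size.
  by case: l {lo hi} => [[|[|[|[|[|[|[|l]]]]]]] ltl] //=; lia.
apply: leq_trans (card_index_interval s lo hi).
apply/subset_leq_card/subsetP => x.
rewrite !inE s_all -val_eqE /= labE => /eqP eql.
have ltxs : index x s < size s by rewrite index_mem.
have szs : size s = n.
  by rewrite /s !size_cat -!cardE; lia.
rewrite /lo /hi -eql /bounds /=; rewrite szs in ltxs.
have : [&& v - a <= 2 * v - a, 2 * v - a <= 3 * v - a,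
             3 * v - a <= n - 3 * a, n - 3 * a <= n - 2 * a
           & n - 2 * a <= n - a] by lia.
move: (v - a) (2 * v - a) (3 * v - a) (n - 3 * a) (n - 2 * a) (n - a).
move: (index x s) ltxs => k ltk t1 t2 t3 t4 t5 t6 /and5P[le1 le2 le3 le4 le5].
by case: (leqP t1 k) => ? /=; case: (leqP t2 k) => ? /=; try lia;
   case: (leqP t3 k) => ? /=; try lia; case: (leqP t4 k) => ? /=; try lia;
   case: (leqP t5 k) => ? /=; try lia; case: (leqP t6 k) => ? /=; lia.
Qed.

Lemma large_component_of_coloring (V : finType) (E : {set {set V}}) (D : nat)
    (f : edge_coloring E 3) :
    small_gaps (adj E) (#|V| * D) -> 1600 * D <= #|V| ->
  exists2 S, mono_component f S & #|V| <= 2 * #|S| + 192 * D.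
Proof.
move=> gapE D_small; pose e i := adj (color_class f i).
have colored x y : adj E x y ->
    [|| e (@Ordinal 3 0 isT) x y, e (@Ordinal 3 1 isT) x y
      | e (@Ordinal 3 2 isT) x y].
  move=> /andP[xy Exy].
  have : e (f (exist _ [set x; y] Exy)) x y.
    by rewrite /e /adj xy /=; apply/mem_color_class; exists Exy.
  case: (f _) => [[|[|[|i]]] lti] // exy; apply/or3P;
    [apply: Or31 | apply: Or32 | apply: Or33];
    congr (is_true (e _ x y)): exy; exact: val_inj.
have [x] := large_monochromatic_component (adj_sym _) (adj_sym _) (adj_sym _)
  colored gapE D_small.
by case=> leV; eexists; try exact: leV; eexists; apply/componentsP; exists x.
Qed.

Definition outer_neighbors (V : finType) (E : {set {set V}}) (A : {set V}) :
    {set V} :=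
  [set v in ~: A | [exists w in A, adj E v w]].

Lemma small_components_coloring (V : finType) (E : {set {set V}}) (A : {set V})
    (a : nat) :
    #|A| = 3 * a -> 0 < a -> 30 * a <= #|V| ->
    6 * #|outer_neighbors E A| < #|V| ->
  exists f : edge_coloring E 3, forall S,
    mono_component f S -> 2 * #|S| + 2 * a <= #|V| + 6.
Proof.
move defn : #|V| => n cA a_gt0 large fewN; set N := outer_neighbors E A in fewN.
pose v := (n - 2 * a) %/ 4.
have NA : N \subset ~: A by apply/subsetP => x; rewrite inE => /andP[].
have [||lab [labA labN sizes]] := @labels_around V A N n a v defn cA NA;
  try by rewrite /v; lia.
have [||f fP] := @small_components_of_labels V E lab a v _ _ sizes; last 1 first.
- by exists f => S /fP; rewrite /v; lia.
- move=> x y xy lt4 ge4; apply: labN; rewrite inE.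
  rewrite inE -labA -ltnNge lt4; apply/existsP; exists y.
  by rewrite -labA ge4.
- by rewrite /v; lia.
Qed.

(** * Union bounds in G(n,p) *)

Local Open Scope classical_set_scope.
Local Open Scope ring_scope.

Lemma sum_powerset_prod (R : realType) (T : finType) (D : {set T})
    (x y : T -> R) :
  \sum_(E in powerset D) \prod_(e in D) (if e \in E then x e else y e) =
  \prod_(e in D) (x e + y e).
Proof.
rewrite [RHS]big_mkcond.
rewrite (eq_bigr (fun e => (if e \in D then x e else 0) +
                           (if e \in D then y e else 1))); last first.
  by move=> e _; case: ifP; rewrite ?add0r.
rewrite bigA_distr [LHS]big_mkcond; apply: eq_bigr => E _.
rewrite inE; case: ifPn => [/subsetP ED|/subsetPn[e Ee NDe]].
  rewrite big_mkcond; apply: eq_bigr => e _.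
  by case: ifP => De; case: ifPn => // /ED; rewrite De.
by rewrite (bigD1 e) //= Ee (negPf NDe) mul0r.
Qed.

Section GnpProbability.
Variables (R : realType) (n : nat) (p : R).
Implicit Types (A : set {set {set 'I_n}}) (E F : {set {set 'I_n}}).

Lemma gnp_prob_contains F : F \subset vpairs 'I_n ->
  gnp_prob p [set E | F \subset E] = p ^+ #|F|.
Proof.
move=> /subsetP FD; rewrite /gnp_prob.
transitivity (\sum_(E in powerset (vpairs 'I_n)) \prod_(e in vpairs 'I_n)
    (if e \in E then p else if e \in F then 0 else 1 - p)).
  rewrite [LHS]big_mkcondr; apply: eq_bigr => E _; rewrite /mkset asboolb.
  case: ifPn => [/subsetP FE|/subsetPn[e Fe NEe]].
    apply: eq_bigr => e _; case: ifPn => // NEe; case: ifPn => // Fe.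
    by rewrite FE in NEe.
  by rewrite (bigD1 e) ?FD //= (negPf NEe) Fe mul0r.
rewrite sum_powerset_prod (eq_bigr (fun e => if e \in F then p else 1)).
  rewrite -big_mkcondr /= (eq_bigl (mem F)) ?prodr_const // => e.
  by apply: andb_idl; apply: FD.
by move=> e _; case: ifP; rewrite ?addr0 // addrC subrK.
Qed.

Lemma gnp_prob_avoids F : F \subset vpairs 'I_n ->
  gnp_prob p [set E | [disjoint F & E]%B] = (1 - p) ^+ #|F|.
Proof.
move=> /subsetP FD; rewrite /gnp_prob.
transitivity (\sum_(E in powerset (vpairs 'I_n)) \prod_(e in vpairs 'I_n)
    (if e \in E then if e \in F then 0 else p else 1 - p)).
  rewrite [LHS]big_mkcondr; apply: eq_bigr => E _; rewrite /mkset asboolb.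
  rewrite disjoints_subset; case: ifPn => [/subsetP FE|/subsetPn[e Fe NEe]].
    apply: eq_bigr => e _; case: ifPn => // Ee; case: ifPn => // /FE.
    by rewrite inE Ee.
  by rewrite inE negbK in NEe; rewrite (bigD1 e) ?FD //= NEe Fe mul0r.
rewrite sum_powerset_prod (eq_bigr (fun e => if e \in F then 1 - p else 1)).
  rewrite -big_mkcondr /= (eq_bigl (mem F)) ?prodr_const // => e.
  by apply: andb_idl; apply: FD.
by move=> e _; case: ifP; rewrite ?add0r // addrC subrK.
Qed.

Lemma gnp_prob_setC A : gnp_prob p A = 1 - gnp_prob p (~` A).
Proof.
have := gnp_prob_contains (sub0set (vpairs 'I_n)).
rewrite cards0 expr0 => <-; apply/eqP; rewrite eq_sym subr_eq; apply/eqP.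
rewrite /gnp_prob (bigID (fun E => `[< A E >])) /=; congr (_ + _).
  by apply: eq_bigl => E; rewrite (asboolT (sub0set E)) andbT.
by apply: eq_bigl => E; rewrite (asboolT (sub0set E)) andbT asbool_neg.
Qed.

Hypothesis p01 : 0 <= p <= 1.

Lemma gnp_mass_ge0 E : 0 <= gnp_mass p E.
Proof.
by case/andP: p01 => p0 p1; apply: prodr_ge0 => e _; case: ifP; lra.
Qed.

Lemma gnp_prob_union (J : finType) (Q : pred J)
    (B : J -> set {set {set 'I_n}}) A :
    (forall E, A E -> exists2 j, Q j & B j E) ->
  gnp_prob p A <= \sum_(j | Q j) gnp_prob p (B j).
Proof.
move=> AB; rewrite /gnp_prob; under [leRHS]eq_bigr do rewrite big_mkcondr.
rewrite [leRHS]exchange_big [leLHS]big_mkcondr /=; apply: ler_sum => E _.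
have ge0 j : 0 <= (if `[< B j E >] then gnp_mass p E else 0).
  by case: ifP => // _; exact: gnp_mass_ge0.
case: ifPn => [/asboolP/AB[j Qj /asboolT BjE]|_]; last exact: sumr_ge0.
by rewrite (bigD1 j) //= BjE lerDl sumr_ge0.
Qed.

(** There are [4 ^ n] pairs of sets, and a pair with [p * #|A| * #|B|] at least
    [3 * n] sees no edge with probability at most exp(-3n), which is less than
    [8 ^- n]. *)
Lemma gnp_prob_large_gap :
  gnp_prob p [set E | exists A B : {set 'I_n},
    disconnects (adj E) A B /\ 3 * n%:R <= p * (#|A| * #|B|)%:R] <= 2 ^- n.
Proof.
pose F (j : {set 'I_n} * {set 'I_n}) : {set {set 'I_n}} :=
  [set [set u.1; u.2] | u in setX j.1 j.2]%SET.
pose Q (j : {set 'I_n} * {set 'I_n}) :=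
  [disjoint j.1 & j.2]%B && (3 * n%:R <= p * (#|j.1| * #|j.2|)%:R).
apply: le_trans (@gnp_prob_union _ Q (fun j => [set E | [disjoint F j & E]%B]) _ _) _.
  move=> E [A [B [/disconnectsP[dAB noE] large]]]; exists (A, B).
    by rewrite /Q dAB.
  rewrite /= disjoints_subset; apply/subsetP => e /imsetP[[x y]].
  rewrite inE /= => /andP[Ax By] ->; rewrite inE.
  have := noE x y Ax By; rewrite /adj negb_and negbK => /orP[/eqP xy|//].
  by have := disjointFr dAB Ax; rewrite xy By.
apply: le_trans (_ : \sum_(j : {set 'I_n} * {set 'I_n}) 8 ^- n <= _); last first.
  rewrite sumr_const card_prod -cardsT -powersetT card_powerset cardsT card_ord.
  rewrite -[leLHS]mulr_natr natrM natrX (_ : 8 = 2 * 2 * 2 :> R) ?exprMn; last by lra.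
  have t_gt0 : 0 < 2 ^+ n :> R by rewrite exprn_gt0.
  by rewrite !invfM -!mulrA mulKf ?mulVf ?mulr1 ?gt_eqF.
rewrite big_mkcond; apply: ler_sum => -[A B] _.
case: ifPn => [/andP[/= dAB large]|_]; last by rewrite invr_ge0 exprn_ge0.
have FD : F (A, B) \subset vpairs 'I_n.
  apply/subsetP => e /imsetP[[x y]]; rewrite inE /= => /andP[Ax By] ->.
  rewrite inE cards2 (_ : x != y) //; apply: contraTneq By => <-.
  by rewrite (disjointFr dAB Ax).
rewrite gnp_prob_avoids // card_in_imset; last first.
  move=> [x y] [x' y']; rewrite !inE /= => /andP[Ax By] /andP[Ax' By'] eqxy.
  have /set2P[xx'|xy'] : x \in [set x'; y']%SET by rewrite -eqxy set21.
    have /set2P[yx'|yy'] : y \in [set x'; y']%SET by rewrite -eqxy set22.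
      by have := disjointFr dAB Ax'; rewrite -yx' By.
    by rewrite xx' yy'.
  by have := disjointFr dAB Ax; rewrite xy' By'.
rewrite cardsX /=.
have [p0 p1] := andP p01.
apply: le_trans (_ : expR (- p) ^+ (#|A| * #|B|) <= _).
  rewrite lerXn2r ?nnegrE ?expR_ge0 ?subr_ge0 //.
  exact: expR_ge1Dx.
rewrite -expRM_natl.
apply: le_trans (_ : expR (- (n%:R * 3)) <= _).
  by rewrite ler_expR mulrN lerN2 mulrC [leRHS]mulrC.
rewrite expRN expRM_natl lef_pV2 ?posrE ?exprn_gt0 ?expR_gt0 //.
rewrite lerXn2r ?nnegrE ?expR_ge0 //.
have -> : (3 : R) = 3%:R * 1 by rewrite mulr1.
rewrite expRM_natl; apply: le_trans (_ : 2 ^+ 3 <= _); first by lra.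
by rewrite lerXn2r ?nnegrE ?expR_ge0 // (le_trans _ (expR_ge1Dx 1)).
Qed.

(** If every vertex of [S] has a neighbor in [A], then the edges to suitably
    chosen neighbors are present, which has probability [p ^ #|S|]. There are
    [#|A| ^ #|S|] choices of neighbors, so each [S] contributes at most
    [(2 ^- 12) ^ #|S|], that is [4 ^- n], and there are [2 ^ n] sets [S]. *)
Lemma gnp_prob_many_neighbors (A : {set 'I_n}) :
  (0 < n)%N -> 2 ^+ 12 * (#|A|%:R * p) <= 1 ->
  gnp_prob p [set E | (n <= 6 * #|outer_neighbors E A|)%N] <= 2 ^- n.
Proof.
move=> n_gt0 smallA; pose a0 : 'I_n := Ordinal n_gt0.
pose F (j : {set 'I_n} * {ffun 'I_n -> 'I_n}) : {set {set 'I_n}} :=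
  [set [set v; j.2 v] | v in j.1]%SET.
pose QS (S : {set 'I_n}) := (n <= 6 * #|S|)%N && (S \subset ~: A)%SET.
pose Q (j : {set 'I_n} * {ffun 'I_n -> 'I_n}) :=
  QS j.1 && (j.2 \in pffun_on a0 (mem j.1) (mem A)).
apply: le_trans (@gnp_prob_union _ Q (fun j => [set E | F j \subset E]) _ _) _.
  move=> E /= manyE; set S := outer_neighbors E A in manyE.
  pose h : {ffun 'I_n -> 'I_n} := [ffun v => if v \in S then
    odflt a0 [pick w in A | adj E v w] else a0].
  have hP v : v \in S -> h v \in A /\ adj E v (h v).
    move=> Sv; rewrite ffunE Sv; case: pickP => [w /andP[//]|noE].
    move: Sv; rewrite inE => /andP[_ /existsP[w]].
    by rewrite noE.
  exists (S, h); last first.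
    by apply/subsetP => e /imsetP[v /hP[_ /andP[_]] + ->].
  rewrite /Q /QS /= manyE /=; apply/andP; split.
    by apply/subsetP => v; rewrite inE => /andP[].
  apply/pffun_onP; split.
    by apply/subsetP => v; rewrite inE /= ffunE; case: ifP => // _; rewrite eqxx.
  by move=> w /imageP[v Sv ->]; have [] := hP v Sv.
rewrite -(pair_big_dep QS (fun S h => h \in pffun_on a0 (mem S) (mem A))
  (fun S h => gnp_prob p [set E | F (S, h) \subset E])) /=.
apply: le_trans (_ : \sum_(S : {set 'I_n}) 4 ^- n <= _); last first.
  rewrite sumr_const -cardsT -powersetT card_powerset cardsT card_ord.
  rewrite -[leLHS]mulr_natr natrX (_ : 4 = 2 * 2 :> R) ?exprMn; last by lra.
  have t_gt0 : 0 < 2 ^+ n :> R by rewrite exprn_gt0.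
  by rewrite invfM -mulrA mulVf ?mulr1 ?gt_eqF.
rewrite big_mkcond; apply: ler_sum => S _.
case: ifPn => [/andP[largeS /subsetP SA]|_]; last by rewrite invr_ge0 exprn_ge0.
rewrite (eq_bigr (fun=> p ^+ #|S|)); last first.
  move=> h /pffun_onP[_ hA].
  have hSA v : v \in S -> h v \in A.
    by move=> Sv; apply: hA; apply/imageP; exists v.
  have vh v : v \in S -> v \notin A by move=> /SA; rewrite inE.
  rewrite gnp_prob_contains ?card_in_imset //=.
    move=> v w Sv Sw eqvw.
    have /set2P[//|vhw] : v \in [set w; h w]%SET by rewrite -eqvw set21.
    by have := vh v Sv; rewrite vhw hSA.
  apply/subsetP => e /imsetP[v Sv ->]; rewrite inE cards2.
  by rewrite (_ : v != h v) //; apply: contraNneq (vh v Sv) => ->; apply: hSA.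
rewrite sumr_const card_pffun_on.
have [p0 p1] := andP p01.
rewrite -[leLHS]mulr_natr natrX -exprMn mulrC.
apply: le_trans (_ : (2 ^- 12) ^+ #|S| <= _).
  rewrite lerXn2r ?nnegrE ?mulr_ge0 ?invr_ge0 ?exprn_ge0 //.
  by move: smallA; rewrite -ler_pdivlMl ?exprn_gt0 // mulr1.
rewrite -exprVn -exprM (_ : 4 = 2 ^+ 2 :> R); last by lra.
rewrite -exprM exprVn lef_pV2 ?posrE ?exprn_gt0 //.
by rewrite ler_eXn2l ?ltr1n //; lia.
Qed.

End GnpProbability.

(** * Transfer to G(n,p) *)

Lemma small_gaps_of_no_large_gap (R : realType) (n : nat) (p : R)
    (E : {set {set 'I_n}}) :
    0 < p ->
    ~ (exists A B : {set 'I_n},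
        disconnects (adj E) A B /\ 3 * n%:R <= p * (#|A| * #|B|)%:R) ->
  small_gaps (adj E) (n * (Num.truncn (3 / p)).+1).
Proof.
move=> p_gt0 noGap A B AB; rewrite ltnNge; apply/negP => large.
apply: noGap; exists A, B; split=> //.
have /ltW : 3 / p < (Num.truncn (3 / p)).+1%:R by rewrite truncnS_gt.
rewrite ler_pdivrMr // => leD.
apply: le_trans (_ : p * (n * (Num.truncn (3 / p)).+1)%:R <= _).
  by rewrite natrM mulrCA mulrC ler_wpM2l // mulrC.
by rewrite ler_wpM2l ?ler_nat // ltW.
Qed.

Theorem theorem1p3 (R : realType) :
  exists c C : R, [/\ 0 < c, 0 < C &
    forall p : nat -> R,
      (forall n : nat, 0 <= p n <= 1) ->
      (n%:R * p n @[n --> \oo] --> +oo) ->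
      (p n @[n --> \oo] --> (0 : R)) ->
      gnp_whp p (fun n => [set G : {set {set 'I_n}} |
        (forall f : edge_coloring G 3, exists2 S : {set 'I_n},
           mono_component f S & n%:R / 2 - C / p n <= #|S|%:R) /\
        (exists f : edge_coloring G 3, forall S : {set 'I_n},
           mono_component f S -> #|S|%:R <= n%:R / 2 - c / p n)])].
Proof.
(* The set whose neighbors are counted has 3a vertices with a <= 1 / (K p),
   hence at most 2 ^- 12 / p. *)
have [K [K_gt0 K_ge1 KE]] : exists K : R,
    [/\ 0 < K, 1 <= K & forall x, 2 ^+ 12 * (3 * x) = K * x].
  exists (2 ^+ 12 * 3); split=> [||x]; last by rewrite mulrA.
    by rewrite mulr_gt0 ?exprn_gt0.
  by rewrite mulr_ege1 ?exprn_ege1 ?ler1n.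
(* C is half of 192 * D, with D about 3 / p and at most 4 / p. For c, half of
   1 / (K p) is given up to absorb all roundings. *)
exists (2 * K)^-1, 384; split; [by rewrite invr_gt0 mulr_gt0|by rewrite ltr0n|].
move=> p p01 np_oo p0.
set good := fun n => _.
have half_cvg : (1 - 2 / 2 ^+ n : R) @[n --> \oo] --> (1 : R).
  rewrite -[X in _ --> X]subr0; apply: cvgB; first exact: cvg_cst.
  have -> : (fun n => 2 / 2 ^+ n : R) = geometric 2 2^-1.
    by apply/funext => n; rewrite /geometric /= exprVn.
  by apply: cvg_geometric; rewrite ger0_norm ?invr_ge0 //; lra.
rewrite /gnp_whp; apply: squeeze_cvgr half_cvg (cvg_cst (1 : R)).
(* This gives 1600 * D <= n, as D is at most 4 / p. *)
have np_large : \forall n \near \oo, (1600 * 4)%:R <= n%:R * p n.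
  by move/cvgryPge: np_oo; exact.
have p_small : \forall n \near \oo, p n <= (8 * K)^-1.
  by apply: (cvgr_le _ p0); rewrite invr_gt0 mulr_gt0.
near=> n.
have np_n : (1600 * 4)%:R <= n%:R * p n by near: n.
have ps : p n <= (8 * K)^-1 by near: n.
have [pn0 pn1] := andP (p01 n).
have np_gt0 : 0 < n%:R * p n.
  by apply: lt_le_trans (_ : (1600 * 4)%:R <= _); [rewrite ltr0n | exact: np_n].
have n_gt0 : (0 < n)%N.
  by rewrite lt0n; apply: contraTneq np_gt0 => ->; rewrite mul0r ltxx.
have p_gt0 : 0 < p n by rewrite -(pmulr_rgt0 _ (_ : 0 < n%:R)) ?ltr0n.
set q := (p n)^-1.
have q_gt0 : 0 < q by rewrite invr_gt0.
have q_ge1 : 1 <= q by rewrite invf_ge1.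
pose w := q / K.
have wq : w <= q by rewrite ler_pdivrMr // ler_peMr // ltW.
have w_large : 8 <= w.
  by rewrite ler_pdivlMr // -[leLHS]invrK lef_pV2 ?posrE ?invr_gt0 ?mulr_gt0.
have cw : (2 * K)^-1 / p n = w / 2.
  by rewrite invfM -/q [RHS]mulrC /w [q / K]mulrC mulrA.
have nq : 30 * q <= n%:R.
  rewrite ler_pdivrMr //; apply: le_trans (_ : (1600 * 4)%:R <= _); last exact: np_n.
  by rewrite ler_nat.
pose a := Num.truncn w; pose D := (Num.truncn (3 / p n)).+1.
have /andP[a_le a_gt] : a%:R <= w < a.+1%:R.
  by rewrite truncn_itv // (le_trans _ w_large).
have /andP[D_le _] : (Num.truncn (3 / p n))%:R <= 3 / p n < D%:R.
  by rewrite truncn_itv ?divr_ge0.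
have DE : D%:R <= 4 * q.
  rewrite /D -natr1; rewrite -/q in D_le; move: D_le q_ge1; clear; lra.
rewrite -natr1 in a_gt.
have a_pos : (0 < a)%N by rewrite -(ltr_nat R); move: a_gt w_large; clear; lra.
have a30 : (30 * a <= n)%N.
  by rewrite -(ler_nat R) natrM; move: a_le wq nq; clear; lra.
have D1600 : (1600 * D <= n)%N.
  rewrite -(ler_nat R) natrM; apply: le_trans (_ : 1600 * (4 * q) <= _).
    by rewrite ler_pM2l ?ltr0n.
  rewrite mulrA ler_pdivrMr // -natrM; exact: np_n.
pose A : {set 'I_n} := [set x in take (3 * a) (enum 'I_n)]%SET.
have cA : #|A| = (3 * a)%N.
  rewrite cardsE (card_uniqP _) ?take_uniq ?enum_uniq // size_takel //.
  by rewrite size_enum_ord (leq_trans _ a30) // leq_mul2r orbT.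
apply/andP; split; last first.
  rewrite gnp_prob_setC gerBl.
  by apply: sumr_ge0 => E _; apply: gnp_mass_ge0.
rewrite gnp_prob_setC lerD2l lerN2.
pose gapped : set {set {set 'I_n}} := [set E | exists A B : {set 'I_n},
    disconnects (adj E) A B /\ 3 * n%:R <= p n * (#|A| * #|B|)%:R].
pose crowded : set {set {set 'I_n}} :=
  [set E | (n <= 6 * #|outer_neighbors E A|)%N].
apply: le_trans (@gnp_prob_union R n (p n) (p01 n) bool predT
  (fun b => if b then gapped else crowded) _ _) _.
  move=> E badE; apply: contrapT => /forall2NP noBad; apply: badE.
  have [[//|noGap] [//|few]] := (noBad true, noBad false).
  have {}few : (6 * #|outer_neighbors E A| < n)%N by rewrite ltnNge; apply/negP.
  have gapE := small_gaps_of_no_large_gap p_gt0 noGap.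
  split=> [f|].
    have [||S fS leS] := @large_component_of_coloring _ E D f; rewrite ?card_ord //.
    exists S => //; move: leS; rewrite card_ord -(ler_nat R) natrD !natrM -/q.
    by move: DE; clear; lra.
  have [||f fP] := @small_components_coloring _ E A a cA a_pos; rewrite ?card_ord //.
  exists f => S /fP; rewrite card_ord -(ler_nat R) natrD [(_ + 6)%:R]natrD.
  rewrite !natrM cw.
  by move: a_gt w_large; clear; lra.
rewrite big_bool /= mulr_natl mulr2n; apply: lerD.
  exact: gnp_prob_large_gap.
apply: gnp_prob_many_neighbors => //.
rewrite cA natrM -mulrA KE mulrA -ler_pdivlMr // div1r mulrC.
by rewrite -ler_pdivlMr.
Unshelve. all: by end_near.
Qed.
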